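(* Let $n\ge 1$ and let $f:\{0,1\}^n\to\{0,1\}$ be a Boolean function with vanishing linear structure. Then the set of mutually orthogonal $3n$-qubit stabilizer states $$\big\{\,|\boldsymbol\alpha\rangle_x|\boldsymbol\beta_1\rangle_z|\boldsymbol\beta_0\rangle_z,\ \ |\boldsymbol\beta_0\rangle_z|\boldsymbol\alpha\rangle_x|\boldsymbol\beta_1\rangle_z,\ \ |\boldsymbol\beta_1\rangle_z|\boldsymbol\beta_0\rangle_z|\boldsymbol\alpha\rangle_x\,\big\},$$ where $\boldsymbol\alpha$ ranges over all of $\{0,1\}^n$, $\boldsymbol\beta_0$ ranges over all $n$-bit strings with $f(\boldsymbol\beta_0)=0$, and $\boldsymbol\beta_1$ ranges over all $n$-bit strings with $f(\boldsymbol\beta_1)=1$, cannot be perfectly discriminated by any stabilizer operations.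
   Context: For $\boldsymbol\alpha=\alpha_1\cdots\alpha_n\in\{0,1\}^n$, $|\boldsymbol\alpha\rangle_x=\big(\bigotimes_{i=1}^n Z_i^{\alpha_i}\big)|+\rangle^{\otimes n}$ with $|+\rangle=\frac1{\sqrt2}(|0\rangle+|1\rangle)$; for $\boldsymbol\beta=\beta_1\cdots\beta_n\in\{0,1\}^n$, $|\boldsymbol\beta\rangle_z=\bigotimes_{i=1}^n|\beta_i\rangle$. Juxtaposition denotes tensor product of the three $n$-qubit blocks. Vanishing linear structure: $f:\{0,1\}^n\to\{0,1\}$ has vanishing linear structure if for every nonzero $\boldsymbol\gamma\in\{0,1\}^n$ there exists $\boldsymbol\beta\in\{0,1\}^n$ with $f(\boldsymbol\beta)\ne f(\boldsymbol\beta+\boldsymbol\gamma)$, where $+$ is bitwise addition modulo 2. Pauli and Clifford groups: $X,Y,Z$ are the single-qubit Pauli matrices; $\mathcal{P}_m=\langle X,Y,Z\rangle^{\otimes m}$ is the $m$-qubit Pauli group; the Clifford group is $\mathrm{Cl}_m=\{V\in U(2^m): V\mathcal{P}_mV^\dagger=\mathcal{P}_m\}$. A pure $m$-qubit stabilizer state is a state of the form $U|0\rangle^{\otimes m}$ (up to phase) with $U\in\mathrm{Cl}_m$. Stabilizer operations: a stabilizer operation is a finite, arbitrarily long sequence of steps, each of one of the following kinds: (1) appending ancillary qubits in computational basis states; (2) applying a Clifford unitary to the qubits currently present; (3) performing a projective measurement of a qubit in the computational basis. The choice of each step may depend adaptively on all previous measurement outcomes. Running a stabilizer operation produces a classical record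 $\boldsymbol a$ of all measurement outcomes. Perfect discrimination: a set $\{|\psi_\mu\rangle\}_\mu$ can be perfectly discriminated by stabilizer operations if there are a stabilizer operation and a function $g$ from records to labels such that, for every $\mu$, when the input is (a single copy of) $|\psi_\mu\rangle$, the record $\boldsymbol a$ satisfies $g(\boldsymbol a)=\mu$ with probability $1$. *)

(* Defs.v *)
From mathcomp Require Import all_boot all_order all_algebra.
From mathcomp Require Import sesquilinear spectral.
From mathcomp Require Import classical_sets.

Set Implicit Arguments.
Unset Strict Implicit.
Unset Printing Implicit Defensive.

Import Order.TTheory GRing.Theory Num.Theory.
Local Open Scope ring_scope.
Local Open Scope sesquilinear_scope.
Local Open Scope classical_set_scope.

(* Bit strings are row vectors over 'F_2, so that [+] is bitwise addition
   modulo 2 and [row_mx] is concatenation. *)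
Notation bits n := 'rV['F_2]_n.

(* The dimension of an m-qubit space.  Vectors and matrices of this size are
   indexed by bit strings through [bits_of] and its inverse [index_of]. *)
Definition qdim (m : nat) : nat := #|{: bits m}|.

Definition bits_of m (i : 'I_(qdim m)) : bits m := enum_val i.
Definition index_of m (x : bits m) : 'I_(qdim m) := enum_rank x.

Lemma qdimE m : qdim m = (2 ^ m)%N.
Proof. by rewrite /qdim card_mx mul1n card_Fp. Qed.

Definition vanishing_linear_structure n (f : bits n -> 'F_2) : Prop :=
  forall gamma : bits n, gamma != 0 ->
    exists beta : bits n, f beta != f (beta + gamma).

Section Qubits.

(* To be instantiated with R[i], R : realType. *)
Variable C : numClosedFieldType.

Notation ket m := 'cV[C]_(qdim m).
Notation op m := 'M[C]_(qdim m).

Definition inner d (u v : 'cV[C]_d) : C := (u ^t* *m v) 0 0.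

(* [(x)_j v_j] and [(x)_j A_j]: the coordinate of a product at the bit string x
   is the product over the qubits j of the coordinates at the bit x_j. *)
Definition tensor_ket m (v : 'I_m -> 'cV[C]_2) : ket m :=
  \col_i \prod_j v j (bits_of i 0 j) 0.

Definition tensor_op m (A : 'I_m -> 'M[C]_2) : op m :=
  \matrix_(i, k) \prod_j A j (bits_of i 0 j) (bits_of k 0 j).

(* The tensor product of two registers of m and k qubits. *)
Definition tensor m k (u : ket m) (v : ket k) : ket (m + k) :=
  \col_i (u (index_of (lsubmx (bits_of i))) 0
          * v (index_of (rsubmx (bits_of i))) 0).

Definition ket1 (b : 'F_2) : 'cV[C]_2 := delta_mx b 0.
Definition ket_plus : 'cV[C]_2 := (sqrtC 2)^-1 *: (ket1 0 + ket1 1).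

Definition pauliX : 'M[C]_2 := delta_mx 0 1 + delta_mx 1 0.
Definition pauliZ : 'M[C]_2 := delta_mx 0 0 - delta_mx 1 1.
Definition pauliY : 'M[C]_2 := 'i *: (delta_mx 1 0 - delta_mx 0 1).

Definition zket n (beta : bits n) : ket n :=
  tensor_ket (fun j => ket1 (beta 0 j)).

Definition xket n (alpha : bits n) : ket n :=
  tensor_op (fun j => pauliZ ^+ (alpha 0 j)) *m tensor_ket (fun=> ket_plus).

(* The group generated by X, Y and Z. *)
Inductive pauli1 : 'M[C]_2 -> Prop :=
| pauli1_X : pauli1 pauliX
| pauli1_Y : pauli1 pauliY
| pauli1_Z : pauli1 pauliZ
| pauli1_1 : pauli1 1%:M
| pauli1_M A B : pauli1 A -> pauli1 B -> pauli1 (A *m B)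
| pauli1_V A : pauli1 A -> pauli1 (invmx A).

Definition pauli m : set (op m) :=
  [set tensor_op A | A in [set A | forall j : 'I_m, pauli1 (A j)]].
Arguments pauli m _ : clear implicits.

Definition clifford m (V : op m) : Prop :=
  V \is unitarymx /\ [set V *m P *m V ^t* | P in pauli m] = pauli m.

Definition stabilizer_state m (psi : ket m) : Prop :=
  exists (U : op m) (c : C),
    [/\ clifford U, `|c| = 1 & psi = c *: (U *m zket 0)].

(* The projector onto the outcome b for qubit j. *)
Definition qubit_proj m (j : 'I_m) (b : 'F_2) : op m :=
  tensor_op (fun l => if l == j then ket1 b *m (ket1 b) ^t* else 1%:M).

(* An adaptive protocol, as a tree: [stab_op m] is what remains to be done when
   m qubits are present, and the continuation after a measurement depends on its
   outcome.  The measured qubit is kept, in its post-measurement state. *)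
Inductive stab_op : nat -> Type :=
| Stop m : stab_op m
| Append m k (b : bits k) (next : stab_op (m + k)) : stab_op m
| Apply m (U : op m) (cU : clifford U) (next : stab_op m) : stab_op m
| Measure m (j : 'I_m) (next : 'F_2 -> stab_op m) : stab_op m.

(* The list of all measurement outcomes, in chronological order. *)
Notation record := (seq 'F_2).

(* The probability that the record produced on the input psi satisfies E.
   Born's rule: outcome b occurs with probability p = |P_b psi|^2 and leaves the
   state P_b psi / sqrt p.  When p = 0 the branch has weight 0, whatever the
   (junk) value of the recursive call. *)
Fixpoint prob_record m (s : stab_op m) : ket m -> pred record -> C :=
  match s in stab_op m return ket m -> pred record -> C with
  | Stop _ => fun _ E => (E [::])%:R
  | Append _ _ b next => fun psi E => prob_record next (tensor psi (zket b)) E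
  | Apply _ U _ next => fun psi E => prob_record next (U *m psi) E
  | Measure _ j next => fun psi E =>
      \sum_(b : 'F_2)
        let phi := qubit_proj j b *m psi in
        let p := inner phi phi in
        p * prob_record (next b) ((sqrtC p)^-1 *: phi)
              [pred a | E (b :: a)]
  end.

Definition perfectly_discriminable m (L : eqType) (psi : L -> ket m) : Prop :=
  exists (s : stab_op m) (g : record -> L),
    forall mu : L, prob_record s (psi mu) [pred a | g a == mu] = 1.

(* The labels (k, alpha, beta_0, beta_1) of the states, where k selects the
   cyclic arrangement of the three blocks. *)
Definition label n (f : bits n -> 'F_2) : eqType :=
  ('I_3 * bits n * {b | f b == 0} * {b | f b == 1})%type.

Definition state_family n (f : bits n -> 'F_2) (mu : label f) : ket (n + n + n) :=
  let: (k, alpha, b0, b1) := mu in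
  match val k with
  | 0 => tensor (tensor (xket alpha) (zket (val b1))) (zket (val b0))
  | 1 => tensor (tensor (zket (val b0)) (xket alpha)) (zket (val b1))
  | _ => tensor (tensor (zket (val b1)) (zket (val b0))) (xket alpha)
  end.

End Qubits.

Arguments pauli C m _ : clear implicits.

(* Main.v *)
(* The computational-basis measurements of a stabilizer operation, pulled back to
   the 3n input qubits, are either deterministic, or a uniformly random change of
   encoding, or a projective measurement of a non-identity Pauli operator P.  As
   long as only the first two kinds occur, the input is still isometrically
   encoded and nothing about it is learnt, so some measurement must be of the
   third kind.  The first such one must keep the states orthogonal in each
   branch (1 +- P)/2, i.e. <psi_mu|P|psi_nu> = 0 for mu != nu.  This fails for
   every P = X^a Z^c up to phase.  If, say, the first block a_1 of a is nonzero,
   the vanishing linear structure gives beta_0 = beta_1 + a_1 with f beta_0 = 0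
   and f beta_1 = 1, and P connects the families with beta_0 and beta_1 in the
   first block, since X- and Z-basis states always overlap in the other two.  If
   a = 0, a nonzero block c_i moves alpha inside the family carrying |alpha>_x in
   block i. *)
Require Import Defs.
From mathcomp Require Import all_boot all_order all_algebra.
From mathcomp Require Import sesquilinear spectral.
From mathcomp Require Import reals classical_sets complex ring.

Set Implicit Arguments.
Unset Strict Implicit.
Unset Printing Implicit Defensive.

Import Order.TTheory GRing.Theory Num.Theory.
Local Open Scope ring_scope.
Local Open Scope sesquilinear_scope.

Section Qubits.

Variable C : numClosedFieldType.

Implicit Types (A B : 'M[C]_2) (m k : nat) (b : 'F_2).

(** * Bit strings as indices, and sums over them *)

Lemma bits_ofK m : cancel (@bits_of m) (@index_of m).
Proof. exact: enum_valK. Qed.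

Lemma index_ofK m : cancel (@index_of m) (@bits_of m).
Proof. exact: enum_rankK. Qed.

Lemma bits_of_inj m : injective (@bits_of m).
Proof. exact: can_inj (@bits_ofK m). Qed.

Lemma sum_bits_of m (F : bits m -> C) :
  \sum_(i < qdim m) F (bits_of i) = \sum_x F x.
Proof.
by rewrite (reindex (@bits_of m)) //; exists (@index_of m) => x _;
   rewrite ?bits_ofK ?index_ofK.
Qed.

Lemma sum_index_of m (F : 'I_(qdim m) -> C) :
  \sum_(i < qdim m) F i = \sum_x F (index_of x).
Proof.
by rewrite (reindex (@index_of m)) //; exists (@bits_of m) => x _;
   rewrite ?bits_ofK ?index_ofK.
Qed.

Lemma sum_bits_row_mx m k (F : bits (m + k) -> C) :
  \sum_x F x = \sum_x \sum_y F (row_mx x y).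
Proof.
rewrite pair_big /= (reindex (fun p : bits m * bits k => row_mx p.1 p.2)) //=.
exists (fun x => (lsubmx x, rsubmx x)) => [[x y]|x] _ /=.
  by rewrite row_mxKl row_mxKr.
by rewrite hsubmxK.
Qed.

(** Distributivity of the product over the sum, with functions on the qubits traded for row vectors.
    The qubitwise formulas for operator products and inner products reduce to it. *)
Lemma sum_prod_bits m (F : 'I_m -> 'I_2 -> C) :
  \sum_(i < qdim m) \prod_j F j (bits_of i 0 j) = \prod_j \sum_b F j b.
Proof.
rewrite (sum_bits_of (fun x => \prod_j F j (x 0 j))) bigA_distr_bigA.
rewrite (reindex (fun x : {ffun 'I_m -> 'F_2} => \row_j x j)) /=.
  by apply: eq_bigr => x _; apply: eq_bigr => j _; rewrite mxE.
exists (fun x : bits m => [ffun j => x 0 j]) => x _.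
  by apply/ffunP => j; rewrite ffunE mxE.
by apply/rowP => j; rewrite mxE ffunE.
Qed.

Lemma sum_F2 (F : 'F_2 -> C) : \sum_b F b = F 0 + F 1.
Proof.
by rewrite big_ord_recl big_ord1; congr (_ + F _); apply/val_inj.
Qed.

(** The types ['F_2] and ['I_2] are convertible but not syntactically equal, and matrix products
    yield sums over the latter. *)
Lemma sum_I2 (F : 'I_2 -> C) : \sum_b F b = F 0 + F 1.
Proof. exact: sum_F2. Qed.

Lemma F2P b : b = 0 \/ b = 1.
Proof. by case: b => [[|[|//]]] ?; [left|right]; apply/val_inj. Qed.

Lemma natb_eq1 (x : bool) : x%:R = 1 :> C -> x.
Proof. by case: x => // /esym/eqP /[!oner_eq0]. Qed.

Definition sgn b : C := (-1) ^+ b.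

Lemma sgn0 : sgn 0 = 1. Proof. by []. Qed.
Lemma sgn1 : sgn 1 = -1. Proof. by rewrite /sgn expr1. Qed.

Lemma sgn_neq0 b : sgn b != 0.
Proof. by rewrite /sgn signr_eq0. Qed.

(** * Tensor products *)

Lemma tensor_opM m (A B : 'I_m -> 'M[C]_2) :
  tensor_op A *m tensor_op B = tensor_op (fun j => A j *m B j).
Proof.
apply/matrixP => i k; rewrite !mxE.
pose F j l := A j (bits_of i 0 j) l * B j l (bits_of k 0 j).
under [LHS]eq_bigr do rewrite !mxE -big_split /=.
by rewrite (sum_prod_bits F); apply: eq_bigr => j _; rewrite mxE.
Qed.

Lemma tensor_op_ket m (A : 'I_m -> 'M[C]_2) (v : 'I_m -> 'cV[C]_2) :
  tensor_op A *m tensor_ket v = tensor_ket (fun j => A j *m v j).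
Proof.
apply/colP => i; rewrite !mxE.
pose F j l := A j (bits_of i 0 j) l * v j l 0.
under [LHS]eq_bigr do rewrite !mxE -big_split /=.
by rewrite (sum_prod_bits F); apply: eq_bigr => j _; rewrite mxE.
Qed.

Lemma tensor_op1 m : tensor_op (fun=> 1%:M) = 1%:M :> 'M[C]_(qdim m).
Proof.
apply/matrixP => i k; rewrite !mxE.
have [->|neq_ik] := eqVneq i k; first by rewrite big1 // => j _; rewrite mxE eqxx.
have [j neq_j] : exists j, bits_of i 0 j != bits_of k 0 j.
  apply/existsP; apply: contraNT neq_ik; rewrite negb_exists => /forallP eq_ik.
  by apply/eqP/bits_of_inj/rowP => j; apply/eqP/negPn.
by rewrite (bigD1 j) //= mxE (negPf neq_j) mul0r.
Qed.

Lemma tensor_op_adj m (A : 'I_m -> 'M[C]_2) :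
  (tensor_op A) ^t* = tensor_op (fun j => (A j) ^t*).
Proof.
apply/matrixP => i k; rewrite !mxE rmorph_prod.
by apply: eq_bigr => j _; rewrite !mxE.
Qed.

Lemma tensor_opZ m (t : 'I_m -> C) (A : 'I_m -> 'M[C]_2) :
  tensor_op (fun j => t j *: A j) = (\prod_j t j) *: tensor_op A.
Proof.
apply/matrixP => i k; rewrite !mxE -big_split.
by apply: eq_bigr => j _; rewrite !mxE.
Qed.

Lemma eq_tensor_op m (A B : 'I_m -> 'M[C]_2) :
  A =1 B -> tensor_op A = tensor_op B.
Proof.
by move=> eqAB; apply/matrixP => i k; rewrite !mxE; apply: eq_bigr => j _;
   rewrite eqAB.
Qed.

Lemma eq_tensor_ket m (u v : 'I_m -> 'cV[C]_2) :
  u =1 v -> tensor_ket u = tensor_ket v.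
Proof.
by move=> equv; apply/colP => i; rewrite !mxE; apply: eq_bigr => j _;
   rewrite equv.
Qed.

Lemma tensorE m k (u : 'cV[C]_(qdim m)) (v : 'cV[C]_(qdim k)) x y :
  tensor u v (index_of (row_mx x y)) 0 = u (index_of x) 0 * v (index_of y) 0.
Proof. by rewrite mxE index_ofK row_mxKl row_mxKr. Qed.

Lemma row_mx_split m k (x : bits (m + k)) :
  exists x1 x2, x = row_mx x1 x2.
Proof. by exists (lsubmx x), (rsubmx x); rewrite hsubmxK. Qed.

Lemma tensorP m k (u v : 'cV[C]_(qdim (m + k))) :
  (forall x y, u (index_of (row_mx x y)) 0 = v (index_of (row_mx x y)) 0) ->
  u = v.
Proof.
move=> equv; apply/colP => i; rewrite -(bits_ofK i) -(hsubmxK (bits_of i)).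
exact: equv.
Qed.

Lemma tensor_op_tensor m k (A : 'I_(m + k) -> 'M[C]_2) u v :
  tensor_op A *m tensor u v =
  tensor (tensor_op (fun j => A (lshift k j)) *m u)
         (tensor_op (fun j => A (rshift m j)) *m v).
Proof.
apply: tensorP => x y; rewrite tensorE !mxE !sum_index_of sum_bits_row_mx.
rewrite mulr_suml; apply: eq_bigr => x' _; rewrite mulr_sumr.
apply: eq_bigr => y' _; rewrite tensorE !mxE !index_ofK big_split_ord /=.
under eq_bigr => j _ do rewrite !row_mxEl.
under [X in _ * X * _]eq_bigr => j _ do rewrite !row_mxEr.
by rewrite mulrACA.
Qed.

Lemma tensor_tensor_ket m k (u : 'I_m -> 'cV[C]_2) (v : 'I_k -> 'cV[C]_2) :
  tensor (tensor_ket u) (tensor_ket v) =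
  tensor_ket (fun j => match split j with inl i => u i | inr i => v i end).
Proof.
apply: tensorP => x y; rewrite tensorE !mxE !index_ofK big_split_ord /=.
by congr (_ * _); apply: eq_bigr => j _; rewrite ?row_mxEl ?row_mxEr
  ?(unsplitK (inl j)) ?(unsplitK (inr j)).
Qed.

(** * Inner products *)

Lemma innerE m (u v : 'cV[C]_m) : inner u v = \sum_i (u i 0)^* * v i 0.
Proof. by rewrite /inner mxE; apply: eq_bigr => i _; rewrite !mxE. Qed.

Lemma inner_tensor m k (u u' : 'cV[C]_(qdim m)) (v v' : 'cV[C]_(qdim k)) :
  inner (tensor u v) (tensor u' v') = inner u u' * inner v v'.
Proof.
rewrite !innerE !sum_index_of sum_bits_row_mx mulr_suml.
apply: eq_bigr => x' _; rewrite mulr_sumr; apply: eq_bigr => y' _.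
by rewrite !tensorE rmorphM mulrACA.
Qed.

Lemma inner_tensor_ket m (u v : 'I_m -> 'cV[C]_2) :
  inner (tensor_ket u) (tensor_ket v) = \prod_j inner (u j) (v j).
Proof.
rewrite innerE.
pose F j l := (u j l 0)^* * v j l 0.
under [LHS]eq_bigr do rewrite !mxE rmorph_prod -big_split /=.
by rewrite (sum_prod_bits F); apply: eq_bigr => j _; rewrite innerE.
Qed.

Lemma inner_mulmxl m k (K : 'M[C]_(m, k)) u v :
  inner (K *m u) v = inner u (K ^t* *m v).
Proof. by rewrite /inner trmx_mul map_mxM mulmxA. Qed.

Lemma innerZl m a (u v : 'cV[C]_m) : inner (a *: u) v = a^* * inner u v.
Proof. by rewrite /inner linearZ map_mxZ -scalemxAl mxE. Qed.

Lemma innerZr m a (u v : 'cV[C]_m) : inner u (a *: v) = a * inner u v.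
Proof. by rewrite /inner -scalemxAr mxE. Qed.

Lemma innerDr m (u v w : 'cV[C]_m) : inner u (v + w) = inner u v + inner u w.
Proof. by rewrite /inner mulmxDr mxE. Qed.

Lemma inner0r m (u : 'cV[C]_m) : inner u 0 = 0.
Proof. by rewrite /inner mulmx0 mxE. Qed.

Lemma inner_ge0 m (u : 'cV[C]_m) : 0 <= inner u u.
Proof. by rewrite innerE sumr_ge0 // => i _; rewrite mulrC mul_conjC_ge0. Qed.

Lemma inner_eq0 m (u : 'cV[C]_m) : inner u u = 0 -> u = 0.
Proof.
move=> u0; apply/colP => i; rewrite mxE.
have /eqP := u0; rewrite innerE psumr_eq0; last first.
  by move=> j _; rewrite mulrC mul_conjC_ge0.
move=> /allP/(_ i); rewrite mem_index_enum mulf_eq0 conjC_eq0 orbb => /(_ isT).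
by move/eqP.
Qed.

Lemma F2xx b : b + b = 0.
Proof. by case: (F2P b) => ->; apply/val_inj. Qed.

(** * Pauli operators *)

Lemma matrix2P A B :
  A 0 0 = B 0 0 -> A 0 1 = B 0 1 -> A 1 0 = B 1 0 -> A 1 1 = B 1 1 -> A = B.
Proof.
move=> e00 e01 e10 e11; apply/matrixP => i k.
have ord2 (l : 'I_2) : l = 0 \/ l = 1 by exact: F2P.
by case: (ord2 i) => ->; case: (ord2 k) => ->.
Qed.

Lemma col2P (u v : 'cV[C]_2) : u 0 0 = v 0 0 -> u 1 0 = v 1 0 -> u = v.
Proof.
move=> e0 e1; apply/colP => i.
have ord2 (l : 'I_2) : l = 0 \/ l = 1 by exact: F2P.
by case: (ord2 i) => ->.
Qed.

(** Pauli matrices modulo phase in symplectic coordinates: [a] records the bit flip and [c] the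
    phase flip, and Y is i X Z. *)
Definition weyl1 (a c : 'F_2) : 'M[C]_2 := pauliX C ^+ a *m pauliZ C ^+ c.

Ltac entries :=
  rewrite ?expr0 ?expr1;
  rewrite ?(mxE, sum_I2) /= ?(mulr1n, mulr0n, mxE, sum_I2) /=
    ?(rmorph0, rmorph1, rmorphN, rmorphM, rmorphB, rmorphD) /=;
  rewrite ?(mul0r, mulr0, mul1r, mulr1, sgn0, sgn1).
Ltac mx2 := apply: matrix2P; entries.

Lemma pauliXX : pauliX C *m pauliX C = 1%:M.
Proof. mx2; ring. Qed.

Lemma pauliZZ : pauliZ C *m pauliZ C = 1%:M.
Proof. mx2; ring. Qed.

Lemma pauliX_adj : (pauliX C) ^t* = pauliX C.
Proof. mx2; ring. Qed.

Lemma pauliZ_adj : (pauliZ C) ^t* = pauliZ C.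
Proof. mx2; ring. Qed.

(** The sign comes from moving Z^c past X^a'. *)
Lemma weyl1M a c a' c' :
  weyl1 a c *m weyl1 a' c' = sgn (c * a') *: weyl1 (a + a') (c + c').
Proof.
by case: (F2P a) => ->; case: (F2P c) => ->; case: (F2P a') => ->;
   case: (F2P c') => ->; rewrite /weyl1; mx2; ring.
Qed.

Lemma pauliYE : pauliY C = 'i *: weyl1 1 1.
Proof. by rewrite /weyl1; mx2; ring. Qed.

Lemma weyl100 : weyl1 0 0 = 1%:M.
Proof. by rewrite /weyl1 mul1mx. Qed.

Lemma weyl101 : weyl1 0 1 = pauliZ C.
Proof. by rewrite /weyl1 mul1mx expr1. Qed.

Lemma mulmx1_invmx n (A B : 'M[C]_n) : A *m B = 1%:M -> B = invmx A.
Proof.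
by move=> AB1; have [uA _] := mulmx1_unit AB1; rewrite -(mulKmx uA B) AB1 mulmx1.
Qed.

Lemma pauli1_weyl1 A :
  pauli1 A -> exists (t : C) a c, t != 0 /\ A = t *: weyl1 a c.
Proof.
elim=> {A} [||||A B _ [t [a [c [t0 ->]]]] _ [t' [a' [c' [t'0 ->]]]]
           |A _ [t [a [c [t0 ->]]]]].
- exists 1, 1, 0; split; first exact: oner_neq0.
  by rewrite /weyl1 mulmx1 expr1 scale1r.
- by exists 'i, 1, 1; rewrite neq0Ci pauliYE.
- by exists 1, 0, 1; rewrite oner_neq0 weyl101 scale1r.
- by exists 1, 0, 0; rewrite oner_neq0 weyl100 scale1r.
- exists (t * t' * sgn (c * a')), (a + a'), (c + c').
  rewrite !mulf_neq0 ?sgn_neq0 //; split=> //.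
  by rewrite -scalemxAl -scalemxAr weyl1M !scalerA.
(* X^a Z^c squares to (-1)^(ac), so it is its own inverse up to that sign. *)
- exists (t^-1 * sgn (a * c)), a, c; rewrite mulf_neq0 ?sgn_neq0 ?invr_neq0 //.
  split=> //.
  have AB1 : (t *: weyl1 a c) *m ((t^-1 * sgn (a * c)) *: weyl1 a c) = 1%:M.
    have -> : (t *: weyl1 a c) *m ((t^-1 * sgn (a * c)) *: weyl1 a c)
        = (t * t^-1 * (sgn (a * c) * sgn (c * a))) *: weyl1 (a + a) (c + c).
      by rewrite -scalemxAl -scalemxAr weyl1M !scalerA; congr (_ *: _); ring.
    by rewrite mulfV // [c * a]mulrC -expr2 sqrr_sign mul1r scale1r !F2xx weyl100.
  by rewrite -(mulmx1_invmx AB1).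
Qed.

Definition weyl m (a c : bits m) : 'M[C]_(qdim m) :=
  tensor_op (fun j => weyl1 (a 0 j) (c 0 j)).

Lemma weyl00 m : weyl 0 0 = 1%:M :> 'M[C]_(qdim m).
Proof.
rewrite -tensor_op1; apply: eq_tensor_op => j.
by rewrite !mxE weyl100.
Qed.

Lemma pauli_weyl m (P : 'M[C]_(qdim m)) :
  pauli C m P -> exists (t : C) a c, t != 0 /\ P = t *: weyl a c.
Proof.
case=> A PA <-.
have /fin_all_exists[t /fin_all_exists[a /fin_all_exists[c Ac]]] j :=
  pauli1_weyl1 (PA j).
exists (\prod_j t j), (\row_j a j), (\row_j c j); split.
  by apply/prodf_neq0 => j _; case: (Ac j).
rewrite -tensor_opZ; apply: eq_tensor_op => j; rewrite !mxE.
by case: (Ac j).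
Qed.

Lemma pauliM m (P Q : 'M[C]_(qdim m)) :
  pauli C m P -> pauli C m Q -> pauli C m (P *m Q).
Proof.
case=> A PA <- [B PB <-]; exists (fun j => A j *m B j).
  by move=> j; apply: pauli1_M.
by rewrite tensor_opM.
Qed.

Definition zop m (j : 'I_m) : 'M[C]_(qdim m) :=
  tensor_op (fun l => if l == j then pauliZ C else 1%:M).

Lemma pauli_zop m (j : 'I_m) : pauli C m (zop j).
Proof.
exists (fun l => if l == j then pauliZ C else 1%:M) => // l.
by case: eqP => _; [apply: pauli1_Z|apply: pauli1_1].
Qed.

Lemma zopK m (j : 'I_m) : zop j *m zop j = 1%:M.
Proof.
rewrite tensor_opM -tensor_op1; apply: eq_tensor_op => l.
by case: ifP; rewrite ?pauliZZ ?mulmx1.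
Qed.

Lemma weyl1Z a c : weyl1 a c *m pauliZ C = sgn a *: (pauliZ C *m weyl1 a c).
Proof.
rewrite -weyl101 !weyl1M mulr0 mul1r sgn0 scale1r add0r addr0 scalerA addrC.
by rewrite -expr2 sqrr_sign scale1r.
Qed.

(** Only a bit flip at qubit [j] anticommutes with Z_j. *)
Lemma zop_comm m (j : 'I_m) (Q : 'M[C]_(qdim m)) :
  pauli C m Q -> exists b, Q *m zop j = sgn b *: (zop j *m Q).
Proof.
move=> /pauli_weyl[t [a [c [_ ->]]]]; exists (a 0 j).
rewrite -scalemxAl -scalemxAr scalerA mulrC -scalerA !tensor_opM; congr (_ *: _).
(* The sign is spread over the qubits, with trivial factors away from [j], so that it can be
   absorbed factor by factor. *)
rewrite [in RHS](_ : sgn _ = \prod_l if l == j then sgn (a 0 j) else 1); last first.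
  by rewrite -big_mkcond big_pred1_eq.
rewrite -tensor_opZ; apply: eq_tensor_op => l.
by case: eqP => [->|_]; rewrite ?weyl1Z // mulmx1 mul1mx scale1r.
Qed.

Lemma qubit_projE m (j : 'I_m) b :
  qubit_proj C j b = 2^-1 *: (1%:M + sgn b *: zop j).
Proof.
rewrite -tensor_op1; apply/matrixP => i k; rewrite !mxE.
(* The three products over qubits agree away from [j]. Splitting off that factor leaves the
   single-qubit identity |b><b| = (1 + (-1)^b Z)/2. *)
rewrite (bigD1 j) //= [X in _ + _ * X](bigD1 j) //= [X in _ * (X + _)](bigD1 j) //=.
rewrite !eqxx.
have off B : \prod_(l | l != j) (if l == j then B else 1%:M)
      (bits_of i 0 l) (bits_of k 0 l) =
    \prod_(l | l != j) (1%:M : 'M[C]_2) (bits_of i 0 l) (bits_of k 0 l).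
  by apply: eq_bigr => l /negPf ->.
rewrite !off mulrA -mulrDl mulrA; congr (_ * _).
have -> : ket1 C b *m (ket1 C b) ^t* = 2^-1 *: (1%:M + sgn b *: pauliZ C).
  by case: (F2P b) => ->; mx2; rewrite ?big_ord1 ?mxE /= ?(rmorph0, rmorph1); field.
by rewrite 5!mxE.
Qed.

Lemma qubit_proj_adj m (j : 'I_m) b : (qubit_proj C j b) ^t* = qubit_proj C j b.
Proof.
rewrite /qubit_proj tensor_op_adj; apply: eq_tensor_op => l.
case: ifP => _; last by rewrite trmx1 map_mx1.
by rewrite trmx_mul map_mxM trmxCK.
Qed.

Lemma qubit_projK m (j : 'I_m) b :
  qubit_proj C j b *m qubit_proj C j b = qubit_proj C j b.
Proof.
rewrite /qubit_proj tensor_opM; apply: eq_tensor_op => l.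
case: ifP => _; last by rewrite mulmx1.
by case: (F2P b) => ->; mx2; rewrite ?big_ord1 ?mxE /= ?(rmorph0, rmorph1); ring.
Qed.

Lemma qubit_proj_sum m (j : 'I_m) : \sum_b qubit_proj C j b = 1%:M.
Proof.
rewrite (bigD1 0) //= (big_pred1 1); last first.
  by move=> b; case: (F2P b) => ->.
rewrite !qubit_projE sgn0 sgn1 -scalerDr scale1r scaleN1r addrACA subrr addr0.
by rewrite -mulr2n -scaler_nat scalerA mulVf ?scale1r // pnatr_eq0.
Qed.

Lemma unitarymx_adj m (U : 'M[C]_m) : U \is unitarymx -> U ^t* *m U = 1%:M.
Proof. by move=> /unitarymxP/mulmx1C. Qed.

(** Conjugation by a Clifford unitary maps onto the Pauli group, so [Q] is itself a conjugate of
    some Pauli operator. *)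
Lemma clifford_comm m (U : 'M[C]_(qdim m)) (Q : 'M[C]_(qdim m)) :
  clifford U -> pauli C m Q -> exists2 P, pauli C m P & Q *m U = U *m P.
Proof.
case=> /unitarymx_adj UU eqP; rewrite -[X in X Q]eqP => -[P pP <-].
by exists P; rewrite // -mulmxA UU mulmx1.
Qed.

Lemma inner_ket1 b b' : inner (ket1 C b) (ket1 C b') = (b == b')%:R.
Proof.
by case: (F2P b) => ->; case: (F2P b') => ->; rewrite innerE; entries; ring.
Qed.

Lemma inner_zket m (x y : bits m) : inner (zket C x) (zket C y) = (x == y)%:R.
Proof.
rewrite inner_tensor_ket; under eq_bigr do rewrite inner_ket1.
have [->|neq_xy] := eqVneq x y; first by rewrite big1 // => j _; rewrite eqxx.
have [j /negPf neq_j] : exists j, x 0 j != y 0 j.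
  apply/existsP; apply: contraNT neq_xy; rewrite negb_exists => /forallP eq_xy.
  by apply/eqP/rowP => j; apply/eqP/negPn.
by rewrite (bigD1 j) //= neq_j mul0r.
Qed.

(** Completeness of the measurement; for [u = v] a unit vector, the outcome probabilities add up to
    1. *)
Lemma sum_inner_qubit_proj m (j : 'I_m) (u v : 'cV[C]_(qdim m)) :
  \sum_b inner (qubit_proj C j b *m u) (qubit_proj C j b *m v) = inner u v.
Proof.
under eq_bigr => b _ do rewrite inner_mulmxl qubit_proj_adj mulmxA qubit_projK.
rewrite -[in RHS](mul1mx v) -(qubit_proj_sum j) mulmx_suml /inner mulmx_sumr.
by rewrite summxE.
Qed.

(** * Adaptive protocols *)

Lemma sqrtCV_conj (p : C) : 0 <= p -> ((sqrtC p)^-1)^* = (sqrtC p)^-1.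
Proof. by move=> p0; rewrite geC0_conj // invr_ge0 sqrtC_ge0. Qed.

Lemma sqrtCV_sqr (p : C) : (sqrtC p)^-1 * (sqrtC p)^-1 = p^-1.
Proof. by rewrite -invfM -expr2 sqrtCK. Qed.

Lemma inner_normalize m (u : 'cV[C]_m) (p := inner u u) :
  p != 0 -> inner ((sqrtC p)^-1 *: u) ((sqrtC p)^-1 *: u) = 1.
Proof.
move=> p0; rewrite innerZl innerZr sqrtCV_conj ?inner_ge0 // mulrA.
by rewrite sqrtCV_sqr mulVf.
Qed.

Lemma prob_record_bounds m (s : stab_op C m) (u : 'cV[C]_(qdim m)) E :
  inner u u = 1 -> 0 <= prob_record s u E <= 1.
Proof.
elim: s u E => {m} [m|m k b s IH|m U cU s IH|m j s IH] u E u1 /=.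
- by case: (E _); rewrite ?ler01 ?lexx.
- by apply: IH; rewrite inner_tensor u1 inner_zket eqxx mulr1.
- by apply: IH; rewrite inner_mulmxl mulmxA unitarymx_adj ?mul1mx //; case: cU.
have term b : let phi := qubit_proj C j b *m u in let p := inner phi phi in
    0 <= p * prob_record (s b) ((sqrtC p)^-1 *: phi) [pred a | E (b :: a)] <= p.
  (* When p = 0 the rescaled vector is not a unit vector and the induction hypothesis says nothing
     about it, but the weight removes the term. *)
  move=> phi p; have [->|p0] := eqVneq p 0; first by rewrite !mul0r lexx.
  have /andP[q0 q1] := IH b _ [pred a | E (b :: a)] (inner_normalize p0).
  by rewrite mulr_ge0 ?inner_ge0 //= ler_piMr ?inner_ge0.
apply/andP; split; first by apply: sumr_ge0 => b _; case/andP: (term b).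
rewrite -u1 -(sum_inner_qubit_proj j); apply: ler_sum => b _.
by case/andP: (term b).
Qed.

(** The total probability is an average of the branch probabilities. Those of positive weight are at
    most 1, so an average equal to 1 forces each of them to be 1. *)
Lemma prob_record_measure m (j : 'I_m) (s : 'F_2 -> stab_op C m)
    (u : 'cV[C]_(qdim m)) E b (phi := qubit_proj C j b *m u) :
  inner u u = 1 -> prob_record (Measure j s) u E = 1 -> phi != 0 ->
  prob_record (s b) ((sqrtC (inner phi phi))^-1 *: phi) [pred a | E (b :: a)] = 1.
Proof.
move=> u1 /= prob1 phi0.
pose p b' := inner (qubit_proj C j b' *m u) (qubit_proj C j b' *m u).
pose q b' := prob_record (s b') ((sqrtC (p b'))^-1 *: (qubit_proj C j b' *m u))
  [pred a | E (b' :: a)].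
have p0 b' : p b' != 0 -> 0 <= q b' <= 1.
  by move=> /inner_normalize p1; apply: prob_record_bounds.
have pq_ge0 b' : true -> 0 <= p b' * (1 - q b').
  move=> _; have [->|/p0/andP[_ q1]] := eqVneq (p b') 0; first by rewrite mul0r.
  by rewrite mulr_ge0 ?inner_ge0 // subr_ge0.
(* The weighted deficits are nonnegative and sum to zero, so each of them vanishes. *)
have : \sum_b' p b' * (1 - q b') = 0.
  under eq_bigr do rewrite mulrBr mulr1.
  by rewrite sumrB sum_inner_qubit_proj u1 prob1 subrr.
move/eqP; rewrite psumr_eq0 // => /allP/(_ b); rewrite mem_index_enum.
move/(_ isT); rewrite /= mulf_eq0 subr_eq0 => /orP[/eqP /inner_eq0 /eqP|/eqP //].
by rewrite (negPf phi0).
Qed.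

(* The inner product of two inputs is the sum over the records of the inner
   products of the unnormalized outputs, and for each record one of the two
   outputs vanishes. *)
Lemma prob_record_orthogonal m (s : stab_op C m) (u v : 'cV[C]_(qdim m))
    (E F : pred (seq 'F_2)) :
  (forall a, ~~ (E a && F a)) -> inner u u = 1 -> inner v v = 1 ->
  prob_record s u E = 1 -> prob_record s v F = 1 -> inner u v = 0.
Proof.
elim: s u v E F => {m} [m|m k b s IH|m U cU s IH|m j s IH] u v E F EF u1 v1.
- by move=> /= /natb_eq1 Et /natb_eq1 Ft; have := EF [::]; rewrite Et Ft.
- move=> /= pu pv; have := IH _ _ _ _ EF _ _ pu pv.
  by rewrite !inner_tensor u1 v1 inner_zket eqxx !mulr1; apply.
- have UU : U ^t* *m U = 1%:M by apply: unitarymx_adj; case: cU.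
  move=> /= pu pv; have := IH _ _ _ _ EF _ _ pu pv.
  by rewrite !inner_mulmxl !mulmxA UU !mul1mx; apply.
move=> pu pv; rewrite -(sum_inner_qubit_proj j) big1 // => b _.
have [->|phi0] := eqVneq (qubit_proj C j b *m v) 0; first exact: inner0r.
have [->|psi0] := eqVneq (qubit_proj C j b *m u) 0.
  by rewrite /inner trmx0 map_mx0 mul0mx mxE.
have nz (w : 'cV[C]_(qdim m)) : w != 0 -> inner w w != 0.
  by apply: contra_neq; apply: inner_eq0.
have /eqP := IH b _ _ _ _ (fun a => EF (b :: a)) (inner_normalize (nz _ psi0))
  (inner_normalize (nz _ phi0)) (prob_record_measure u1 pu psi0)
  (prob_record_measure v1 pv phi0).
(* The normalizing scalars are nonzero, so orthogonality of the normalized branches is orthogonality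
   of the projections. *)
rewrite innerZl innerZr !mulf_eq0 conjC_eq0 !invr_eq0 !sqrtC_eq0.
by rewrite (negPf (nz _ phi0)) (negPf (nz _ psi0)) => /eqP.
Qed.

(** * Stabilizer encodings of the input *)

Lemma adjmxM m k l (A : 'M[C]_(m, k)) (B : 'M[C]_(k, l)) :
  (A *m B) ^t* = B ^t* *m A ^t*.
Proof. by rewrite trmx_mul map_mxM. Qed.

Lemma adjmxZ m k t (A : 'M[C]_(m, k)) : (t *: A) ^t* = t^* *: A ^t*.
Proof. by rewrite linearZ map_mxZ. Qed.

Lemma tensor_ketZ m (t : 'I_m -> C) (v : 'I_m -> 'cV[C]_2) :
  tensor_ket (fun j => t j *: v j) = (\prod_j t j) *: tensor_ket v.
Proof.
apply/colP => i; rewrite !mxE -big_split.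
by apply: eq_bigr => j _; rewrite !mxE.
Qed.

Lemma weyl1_ket1 a c b : weyl1 a c *m ket1 C b = sgn (c * b) *: ket1 C (b + a).
Proof.
by case: (F2P a) => ->; case: (F2P b) => ->; case: (F2P c) => ->;
   rewrite /weyl1; apply: col2P; entries; ring.
Qed.

Lemma weyl_zket m (a c x : bits m) :
  exists2 s : C, s != 0 & weyl a c *m zket C x = s *: zket C (x + a).
Proof.
exists (\prod_j sgn (c 0 j * x 0 j)).
  by apply/prodf_neq0 => j _; apply: sgn_neq0.
rewrite tensor_op_ket -tensor_ketZ; apply: eq_tensor_ket => j.
by rewrite weyl1_ket1 !mxE.
Qed.

Lemma eq_mx_inner m k (A B : 'M[C]_(m, k)) :
  (forall u v, inner u (A *m v) = inner u (B *m v)) -> A = B.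
Proof.
move=> eqAB; apply/matrixP => i j.
have entry (D : 'M[C]_(m, k)) : inner (delta_mx i 0) (D *m delta_mx j 0) = D i j.
  rewrite innerE -colE (bigD1 i) //= big1 ?addr0 => [|l /negPf neq_l].
    by rewrite !mxE !eqxx rmorph1 mul1r.
  by rewrite !mxE neq_l rmorph0 mul0r.
by rewrite -!entry eqAB.
Qed.

Lemma eq_mulmx_col m k (A B : 'M[C]_(m, k)) :
  (forall v : 'cV_k, A *m v = B *m v) -> A = B.
Proof. by move=> eqAB; apply: eq_mx_inner => u v; rewrite eqAB. Qed.

Lemma tensorZr m k (u : 'cV[C]_(qdim m)) t (v : 'cV[C]_(qdim k)) :
  tensor u (t *: v) = t *: tensor u v.
Proof. by apply/colP => i; rewrite !mxE mulrCA. Qed.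

Lemma tensorZl m k (u : 'cV[C]_(qdim m)) t (v : 'cV[C]_(qdim k)) :
  tensor (t *: u) v = t *: tensor u v.
Proof. by apply/colP => i; rewrite !mxE mulrA. Qed.

(** The isometry adjoining ancillas, as a rectangular matrix, so that the encoding reached so far is
    always a single matrix applied to the input. *)
Definition append_mx m k (x : bits k) : 'M[C]_(qdim (m + k), qdim m) :=
  \matrix_(i, j) tensor (delta_mx j 0) (zket C x) i 0.

Lemma append_mxE m k (x : bits k) (u : 'cV[C]_(qdim m)) :
  append_mx m x *m u = tensor u (zket C x).
Proof.
apply: tensorP => y z; rewrite tensorE mxE (bigD1 (index_of y)) //= big1.
  by rewrite mxE tensorE [delta_mx _ _ _ _]mxE !eqxx mul1r addr0 mulrC.
move=> j; rewrite eq_sym => /negPf neq_j.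
by rewrite mxE tensorE [delta_mx _ _ _ _]mxE neq_j !mul0r.
Qed.

Section PauliIsometry.

Variable N : nat.

(* K is a stabilizer encoding: a Pauli is either logical or has no component in
   the code space. *)
Definition pauli_isometry m (K : 'M[C]_(qdim m, qdim N)) :=
  K ^t* *m K = 1%:M /\
  forall Q, pauli C m Q -> K ^t* *m Q *m K = 0 \/
    exists (t : C) P, pauli C N P /\ Q *m K = t *: (K *m P).

Lemma pauli_isometry1 : pauli_isometry (1%:M : 'M[C]_(qdim N)).
Proof.
split=> [|Q pQ]; first by rewrite trmx1 map_mx1 mulmx1.
by right; exists 1, Q; rewrite scale1r mulmx1 mul1mx.
Qed.

(** A Pauli operator splits as A1 on the old qubits times A2 on the ancillas. If A2 flips an ancilla
    bit, the code space is sent to an orthogonal one; otherwise A2 contributes a scalar and A1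
    decides. *)
Lemma pauli_isometry_append m k (x : bits k) (K : 'M[C]_(qdim m, qdim N)) :
  pauli_isometry K -> pauli_isometry (append_mx m x *m K).
Proof.
case=> KK logK.
have adjE (B : 'M[C]_(qdim (m + k))) u v :
    inner u ((append_mx m x *m K) ^t* *m B *m (append_mx m x *m K) *m v) =
    inner (append_mx m x *m (K *m u)) (B *m (append_mx m x *m (K *m v))).
  by rewrite -!mulmxA -inner_mulmxl -mulmxA.
split.
  apply: eq_mx_inner => u v; rewrite -(mulmx1 (_ ^t*)) adjE mul1mx !append_mxE.
  by rewrite inner_tensor inner_zket eqxx mulr1 inner_mulmxl mulmxA KK.
move=> Q [A pA <-].
set A1 := fun j => A (lshift k j); set A2 := fun j => A (rshift m j).
have [t [a [c [t0 A2E]]]] : exists (t : C) a c, t != 0 /\ tensor_op A2 = t *: weyl a c.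
  by apply: pauli_weyl; exists A2 => // j; apply: pA.
have [s s0 A2x] := weyl_zket a c x.
have QE (u : 'cV[C]_(qdim m)) : tensor_op A *m (append_mx m x *m u) =
    (t * s) *: tensor (tensor_op A1 *m u) (zket C (x + a)).
  by rewrite append_mxE tensor_op_tensor A2E -scalemxAl A2x scalerA tensorZr.
have [a0|a0] := eqVneq a 0; last first.
  left; apply: eq_mx_inner => u v; rewrite adjE QE append_mxE innerZr inner_tensor.
  rewrite inner_zket -{1}[x]addr0 (inj_eq (addrI x)) eq_sym (negPf a0).
  by rewrite !mulr0 mul0mx inner0r.
have pA1 : pauli C m (tensor_op A1) by exists A1 => // j; apply: pA.
case: (logK _ pA1) => [K0|[r [P [pP PE]]]].
  left; apply: eq_mx_inner => u v; rewrite adjE QE append_mxE innerZr inner_tensor.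
  by rewrite inner_mulmxl !mulmxA K0 !mul0mx !inner0r mul0r mulr0.
right; exists (t * s * r), P; split=> //; apply: eq_mulmx_col => v.
rewrite -!mulmxA QE !mulmxA PE -!(scalemxAl, mulmxA) append_mxE tensorZl a0 addr0.
by rewrite !scalerA.
Qed.

(** Moving [Q] through [U] turns it into another Pauli operator, to which the property of [K]
    applies. *)
Lemma pauli_isometry_clifford m (U : 'M[C]_(qdim m)) K :
  clifford U -> pauli_isometry K -> pauli_isometry (U *m K).
Proof.
move=> cU [KK logK]; have UU : U ^t* *m U = 1%:M.
  by apply: unitarymx_adj; case: cU.
have adjE (B : 'M_(qdim m, qdim N)) : (U *m K) ^t* *m (U *m B) = K ^t* *m B.
  by rewrite adjmxM -mulmxA (mulmxA (U ^t*)) UU mul1mx.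
split=> [|Q /(clifford_comm cU)[Q' pQ' QU]]; first by rewrite adjE.
rewrite -mulmxA (mulmxA Q) QU -(mulmxA U) adjE.
case: (logK _ pQ') => [K0|[r [P [pP PE]]]]; first by left; rewrite mulmxA.
by right; exists r, P; rewrite PE -scalemxAr mulmxA.
Qed.

(* If the measured Z anticommutes with a stabilizer of the code, the outcome is
   uniformly random and the code is merely rotated: of the Paulis Q and ZQ, which
   coincide up to sign after the projection, at least one may still be logical. *)
Lemma pauli_isometry_random m (j : 'I_m) b K :
  pauli_isometry K -> K ^t* *m zop j *m K = 0 ->
  K ^t* *m qubit_proj C j b *m K = 2^-1 *: 1%:M /\
  pauli_isometry ((sqrtC 2^-1)^-1 *: (qubit_proj C j b *m K)).
Proof.
move=> [KK logK] KZK; set p := qubit_proj C j b.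
have KpQK Q : K ^t* *m (p *m Q) *m K =
    2^-1 *: (K ^t* *m Q *m K + sgn b *: (K ^t* *m (zop j *m Q) *m K)).
  rewrite /p qubit_projE -!(scalemxAl, scalemxAr); congr (_ *: _).
  by rewrite mulmxDl mulmxDr mulmxDl mul1mx -!(scalemxAl, scalemxAr).
have KpK : K ^t* *m p *m K = 2^-1 *: 1%:M.
  by rewrite -[p]mulmx1 KpQK !mulmx1 KZK scaler0 addr0 KK.
have half_ge0 : 0 <= 2^-1 :> C by rewrite invr_ge0 ler0n.
have adjE (B : 'M_(qdim m)) : ((sqrtC 2^-1)^-1 *: (p *m K)) ^t* *m B *m
    ((sqrtC 2^-1)^-1 *: (p *m K)) = 2 *: (K ^t* *m (p *m B *m p) *m K).
  rewrite adjmxZ adjmxM qubit_proj_adj sqrtCV_conj //.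
  rewrite -!scalemxAl -scalemxAr scalerA sqrtCV_sqr invrK.
  by rewrite !mulmxA.
split=> //; split.
  rewrite -[X in X *m _]mulmx1 adjE mulmx1 qubit_projK KpK scalerA.
  by rewrite mulfV ?scale1r // pnatr_eq0.
move=> Q pQ; have [a QZ] := zop_comm j pQ.
(* If [Q] anticommutes with Z_j, it exchanges the two outcome spaces, so its compression by [p]
   vanishes. The other case is that [Q] commutes with [p]. *)
case: (F2P a) QZ => -> QZ; last first.
  have pQp : p *m Q *m p = 0.
    have ZQ0 : (1%:M + sgn b *: zop j) *m Q *m (1%:M + sgn b *: zop j) = 0.
      rewrite mulmxDl mul1mx -scalemxAl mulmxDr mulmx1 -scalemxAr mulmxDl.
      rewrite -scalemxAl -mulmxA QZ sgn1 scaleN1r mulmxN mulmxA zopK mul1mx.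
      rewrite scalerDr !scalerN !scalerA -expr2 sqrr_sign scale1r -opprD.
      by rewrite [X in _ - X]addrC subrr.
    by rewrite /p qubit_projE -!(scalemxAl, scalemxAr) ZQ0 !scaler0.
  by left; rewrite adjE pQp mulmx0 mul0mx scaler0.
rewrite sgn0 scale1r in QZ.
have pQ_comm : Q *m p = p *m Q.
  rewrite /p qubit_projE -!(scalemxAl, scalemxAr) mulmxDl mulmxDr mulmx1 mul1mx.
  by rewrite -!(scalemxAl, scalemxAr) QZ.
have push t P : Q *m K = t *: (K *m P) -> Q *m ((sqrtC 2^-1)^-1 *: (p *m K)) =
    t *: (((sqrtC 2^-1)^-1 *: (p *m K)) *m P).
  move=> QK; rewrite -!(scalemxAl, scalemxAr) scalerA mulrC -scalerA.
  congr (_ *: _).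
  by rewrite mulmxA pQ_comm -mulmxA QK -scalemxAr mulmxA.
(* A [Q] that was already logical stays so with the same logical operator. Otherwise Z_j [Q] is
   examined; if that has no component in the old code either, [Q] has none in the new one. *)
case: (logK _ pQ) => [KQK|[t [P [pP /push]]]]; last by right; exists t, P.
have pZQ := pauliM (pauli_zop j) pQ.
case: (logK _ pZQ) => [KZQK|[t [P [pP ZQK]]]].
  left; rewrite adjE -(mulmxA p) pQ_comm (mulmxA p) qubit_projK KpQK KQK KZQK.
  by rewrite scaler0 addr0 !scaler0.
right; exists (sgn b * t), P; split=> //.
(* On the range of [p], Z_j is the scalar (-1)^b, which lets Z_j [Q] stand in for [Q]. *)
have pZ : p *m zop j = sgn b *: p.
  rewrite /p qubit_projE -!(scalemxAl, scalemxAr) mulmxDl mul1mx -scalemxAl zopK.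
  rewrite scalerA mulrC -scalerA; congr (_ *: _).
  by rewrite scalerDr scalerA -expr2 sqrr_sign scale1r addrC.
have pQE : p *m Q = sgn b *: (p *m (zop j *m Q)).
  by rewrite mulmxA pZ -scalemxAl scalerA -expr2 sqrr_sign scale1r.
rewrite -!(scalemxAl, scalemxAr) mulmxA pQ_comm pQE -scalemxAl. 
rewrite -(mulmxA p (zop j *m Q)) ZQK.
by rewrite -scalemxAr !scalerA !mulmxA; congr (_ *: _); ring.
Qed.

End PauliIsometry.

(** Induction on the protocol, maintaining a stabilizer encoding [K] of the input. The map [g] is
    generalized because a measurement prefixes its outcome to the record. Ancillas and Clifford
    steps only change [K]; a measurement falls into one of three cases. *)
Lemma pauli_isometry_not_discriminating (N : nat) (L : eqType)
    (psi : L -> 'cV[C]_(qdim N)) (mu0 nu0 : L) :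
  mu0 != nu0 ->
  (forall mu nu, inner (psi mu) (psi nu) = (mu == nu)%:R) ->
  (forall a c : bits N, (a != 0) || (c != 0) ->
    exists mu nu, mu != nu /\ inner (psi mu) (weyl a c *m psi nu) != 0) ->
  forall m (s : stab_op C m) (g : seq 'F_2 -> L) (K : 'M[C]_(qdim m, qdim N)),
  pauli_isometry K ->
  ~ (forall mu, prob_record s (K *m psi mu) [pred a | g a == mu] = 1).
Proof.
move=> neq_mu_nu psi_on psi_weyl m s.
elim: s => {m} [m|m k x s IH|m U cU s IH|m j s IH] g K iK prob1.
(* At a leaf the remaining record is empty, and its one value under [g] would have to be two
   distinct labels. *)
- have /eqP g_mu := natb_eq1 (prob1 mu0).
  have /eqP g_nu := natb_eq1 (prob1 nu0).
  by rewrite -g_mu -g_nu eqxx in neq_mu_nu.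
- apply: IH (pauli_isometry_append x iK) _ => mu.
  by rewrite -mulmxA append_mxE; apply: prob1.
- apply: IH (pauli_isometry_clifford cU iK) _ => mu.
  by rewrite -mulmxA; apply: prob1.
have [KK logK] := iK.
have normK mu : inner (K *m psi mu) (K *m psi mu) = 1.
  by rewrite inner_mulmxl mulmxA KK mul1mx psi_on eqxx.
have innerP b mu nu : inner (qubit_proj C j b *m (K *m psi mu))
    (qubit_proj C j b *m (K *m psi nu)) =
    inner (psi mu) (K ^t* *m qubit_proj C j b *m K *m psi nu).
  rewrite inner_mulmxl qubit_proj_adj (mulmxA (qubit_proj C j b)) qubit_projK.
  by rewrite inner_mulmxl !mulmxA.
have step b mu := prob_record_measure (b := b) (normK mu) (prob1 mu).
have neq0 (u : 'cV[C]_(qdim m)) : inner u u != 0 -> u != 0.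
  by apply: contra_neq => ->; rewrite inner0r.
(* Random case: every input yields outcome 0 with probability 1/2, so that branch still encodes all
   the states and the rest of the protocol would have to discriminate them. *)
have [KZK|KZK] := eqVneq (K ^t* *m zop j *m K) 0.
  have [KpK iK'] := pauli_isometry_random 0 iK KZK.
  apply: (IH 0 (fun a => g (0 :: a)) _ iK') => mu.
  have p_half : inner (qubit_proj C j 0 *m (K *m psi mu))
      (qubit_proj C j 0 *m (K *m psi mu)) = 2^-1.
    by rewrite innerP KpK -scalemxAl mul1mx innerZr psi_on eqxx mulr1.
  have phi0 : qubit_proj C j 0 *m (K *m psi mu) != 0.
    by apply: neq0; rewrite p_half invr_eq0 pnatr_eq0.
  by have := step 0 mu phi0; rewrite p_half -scalemxAl mulmxA.
have [r [a [c ZK]]] : exists (r : C) a c, zop j *m K = r *: (K *m weyl a c).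
  case: (logK _ (pauli_zop j)) => [K0|[t [P [/pauli_weyl[t' [a [c [_ ->]]]] ->]]]].
    by rewrite K0 eqxx in KZK.
  by exists (t * t'), a, c; rewrite -scalemxAr scalerA.
have r0 : r != 0.
  by apply: contra_neq KZK => r0; rewrite -mulmxA ZK r0 scale0r mulmx0.
(* Deterministic case, where Z_j acts as a logical scalar: all inputs give the same outcome and are
   left unchanged. *)
have [/andP[/eqP a0 /eqP c0]|] := boolP ((a == 0) && (c == 0)).
  have {}ZK : zop j *m K = r *: K by rewrite ZK a0 c0 weyl00 mulmx1.
  (* Z_j squares to the identity and encoded states have norm 1, so the eigenvalue is a sign. *)
  have [b rb] : exists b, r = sgn b.
    have : r ^+ 2 = 1.
      have K2 : K = r ^+ 2 *: K.
        by rewrite -[LHS]mul1mx -(zopK j) -mulmxA ZK -scalemxAr ZK scalerA.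
      by have := normK mu0; rewrite {2}K2 -scalemxAl innerZr normK mulr1.
    move/eqP; rewrite sqrf_eq1 => /orP[]/eqP->.
      by exists 0; rewrite sgn0.
    by exists 1; rewrite sgn1.
  have pK mu : qubit_proj C j b *m (K *m psi mu) = K *m psi mu.
    rewrite qubit_projE -scalemxAl mulmxDl mul1mx -scalemxAl mulmxA ZK rb.
    rewrite -scalemxAl scalerA -expr2 sqrr_sign scale1r -mulr2n -scaler_nat.
    by rewrite scalerA mulVf ?scale1r // pnatr_eq0.
  apply: (IH b (fun a => g (b :: a)) _ iK) => mu.
  have := step b mu; rewrite pK normK sqrtC1 invr1 scale1r; apply.
  by apply: neq0; rewrite normK oner_neq0.
rewrite negb_and => /psi_weyl[mu [nu [neq_munu weyl_neq0]]].
(* Informative case: the two states are orthogonal, so only the Z_j term of the projector survives,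
   and it connects them. Yet the continuation separates the two projected states, which forces them
   to be orthogonal. *)
have inner_neq0 : inner (qubit_proj C j 0 *m (K *m psi mu))
    (qubit_proj C j 0 *m (K *m psi nu)) != 0.
  rewrite innerP qubit_projE -(scalemxAr, scalemxAl) -!scalemxAl innerZr.
  rewrite mulmxDr mulmx1 mulmxDl KK mulmxDl mul1mx innerDr psi_on (negPf neq_munu).
  rewrite add0r sgn0 scale1r -!mulmxA (mulmxA (zop j)) ZK -scalemxAl -mulmxA.
  rewrite -scalemxAr innerZr (mulmxA (K ^t*)) KK mul1mx.
  by rewrite !mulf_neq0 // invr_eq0 pnatr_eq0.
have phi_mu : qubit_proj C j 0 *m (K *m psi mu) != 0.
  by apply: contra_neq inner_neq0 => ->; rewrite /inner trmx0 map_mx0 mul0mx mxE.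
have phi_nu : qubit_proj C j 0 *m (K *m psi nu) != 0.
  by apply: contra_neq inner_neq0 => ->; rewrite inner0r.
have nz (w : 'cV[C]_(qdim m)) : w != 0 -> inner w w != 0.
  by apply: contra_neq; apply: inner_eq0.
have disj t : ~~ ((g (0 :: t) == mu) && (g (0 :: t) == nu)).
  by apply: contra neq_munu => /andP[/eqP <-].
have /eqP := prob_record_orthogonal disj (inner_normalize (nz _ phi_mu))
  (inner_normalize (nz _ phi_nu)) (step 0 mu phi_mu) (step 0 nu phi_nu).
rewrite innerZl innerZr !mulf_eq0 conjC_eq0 !invr_eq0 !sqrtC_eq0.
by rewrite (negPf (nz _ phi_mu)) (negPf (nz _ phi_nu)) (negPf inner_neq0).
Qed.

(** * The state family *)

Definition xket1 b : 'cV[C]_2 := pauliZ C ^+ b *m ket_plus C.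

Lemma xketE m (x : bits m) : xket C x = tensor_ket (fun j => xket1 (x 0 j)).
Proof. by rewrite /xket tensor_op_ket. Qed.

Lemma sqrt2V_conj : ((sqrtC 2)^-1)^* = (sqrtC 2)^-1 :> C.
Proof. by apply: sqrtCV_conj; rewrite ler0n. Qed.

Lemma xket1E b : xket1 b = (sqrtC 2)^-1 *: (ket1 C 0 + sgn b *: ket1 C 1).
Proof. by case: (F2P b) => ->; rewrite /xket1; apply: col2P; entries; ring. Qed.

Lemma inner_xket1 b b' : inner (xket1 b) (xket1 b') = (b == b')%:R.
Proof.
rewrite !xket1E innerZl innerZr sqrt2V_conj mulrA sqrtCV_sqr innerE.
have two0 : 2 != 0 :> C by rewrite pnatr_eq0.
by case: (F2P b) => ->; case: (F2P b') => ->; entries; field.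
Qed.

Lemma inner_xket1_ket1 b b' : inner (xket1 b) (ket1 C b') != 0.
Proof.
rewrite xket1E innerZl sqrt2V_conj mulf_neq0 //.
  by rewrite invr_eq0 sqrtC_eq0 pnatr_eq0.
have one0 : (-1) != 0 :> C by rewrite oppr_eq0 oner_eq0.
by case: (F2P b) => ->; case: (F2P b') => ->; rewrite innerE; entries;
   rewrite ?addr0 ?add0r ?mulr1 ?oner_eq0.
Qed.

(** In the X basis the exponents exchange roles: Z shifts the label and X only contributes a
    sign. *)
Lemma weyl1_xket1 a c b :
  weyl1 a c *m xket1 b = sgn (a * (b + c)) *: xket1 (b + c).
Proof.
rewrite !xket1E; case: (F2P a) => ->; case: (F2P b) => ->; case: (F2P c) => ->;
  rewrite ?(F2xx, addr0, add0r) /weyl1; apply: col2P; entries; ring.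
Qed.

Lemma inner_xket m (x y : bits m) : inner (xket C x) (xket C y) = (x == y)%:R.
Proof.
rewrite !xketE -inner_zket !inner_tensor_ket; apply: eq_bigr => j _.
by rewrite inner_xket1 inner_ket1.
Qed.

(** The X and Z bases are mutually unbiased, so the overlap is nonzero at every qubit. *)
Lemma inner_xket_zket m (x y : bits m) : inner (xket C x) (zket C y) != 0.
Proof.
rewrite xketE inner_tensor_ket; apply/prodf_neq0 => j _.
exact: inner_xket1_ket1.
Qed.

Lemma inner_conj m (u v : 'cV[C]_m) : inner u v = (inner v u)^*.
Proof.
rewrite !innerE rmorph_sum; apply: eq_bigr => i _.
by rewrite rmorphM /= conjCK mulrC.
Qed.

Lemma weyl_xket m (a c x : bits m) :
  exists2 s : C, s != 0 & weyl a c *m xket C x = s *: xket C (x + c).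
Proof.
exists (\prod_j sgn (a 0 j * (x 0 j + c 0 j))).
  by apply/prodf_neq0 => j _; apply: sgn_neq0.
rewrite !xketE tensor_op_ket -tensor_ketZ; apply: eq_tensor_ket => j.
by rewrite weyl1_xket1 !mxE.
Qed.

Lemma weyl_zz m (a c x : bits m) :
  inner (zket C (x + a)) (weyl a c *m zket C x) != 0.
Proof.
have [s s0 ->] := weyl_zket a c x.
by rewrite innerZr inner_zket eqxx mulr1.
Qed.

Lemma weyl_xx m (a c x : bits m) :
  inner (xket C (x + c)) (weyl a c *m xket C x) != 0.
Proof.
have [s s0 ->] := weyl_xket a c x.
by rewrite innerZr inner_xket eqxx mulr1.
Qed.

(** A Weyl operator permutes the Z basis up to scalars, so it cannot destroy the overlap with an
    X-basis vector. *)
Lemma weyl_xz m (a c x y : bits m) :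
  inner (xket C x) (weyl a c *m zket C y) != 0.
Proof.
have [s s0 ->] := weyl_zket a c y.
by rewrite innerZr mulf_neq0 ?inner_xket_zket.
Qed.

Lemma weyl_zx m (a c x y : bits m) :
  inner (zket C x) (weyl a c *m xket C y) != 0.
Proof.
have [s s0 ->] := weyl_xket a c y.
by rewrite innerZr mulf_neq0 // inner_conj conjC_eq0 inner_xket_zket.
Qed.

Lemma weyl_tensor m k (a c : bits m) (a' c' : bits k) u v :
  weyl (row_mx a a') (row_mx c c') *m tensor u v =
  tensor (weyl a c *m u) (weyl a' c' *m v).
Proof.
rewrite tensor_op_tensor; congr tensor; congr mulmx;
  by apply: eq_tensor_op => j; rewrite ?row_mxEl ?row_mxEr.
Qed.

Section Family.

Variables (n : nat) (f : bits n -> 'F_2).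

(** Any two different cyclic arrangements have a block where one carries beta_0 and the other
    beta_1, and [f] tells these strings apart. *)
Lemma inner_state_family (mu nu : label f) :
  inner (state_family C mu) (state_family C nu) = (mu == nu)%:R.
Proof.
have neq01 (b0 : {b | f b == 0}) (b1 : {b | f b == 1}) :
    inner (zket C (val b0)) (zket C (val b1)) = 0 /\
    inner (zket C (val b1)) (zket C (val b0)) = 0.
  rewrite !inner_zket [val b1 == _]eq_sym.
  case: eqP => // eq01; have := valP b1.
  by rewrite -eq01 (eqP (valP b0)).
case: mu nu => [[[k x] b0] b1] [[[k' x'] b0'] b1'].
rewrite !xpair_eqE /state_family.
have [z01 z10] := neq01 b0 b1'; have [z01' z10'] := neq01 b0' b1.
case: k k' => [[|[|[|//]]] lt_k] [[|[|[|//]]] lt_k'] /=; rewrite !inner_tensor;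
  rewrite ?(z01, z10, z01', z10', mulr0, mul0r) //;
  rewrite !inner_xket !inner_zket -!natrM !mulnb !val_eqE; congr (_%:R);
  by do 3 case: (_ == _).
Qed.

Lemma state_family_weyl :
  (0 < n)%N -> vanishing_linear_structure f ->
  forall a c : bits (n + n + n), (a != 0) || (c != 0) ->
  exists mu nu : label f, mu != nu /\
    inner (state_family C mu) (weyl a c *m state_family C nu) != 0.
Proof.
move=> n_gt0 vls a c ac0.
pose lab0 x (fx : f x = 0) : {x | f x == 0} := exist _ x (introT eqP fx).
pose lab1 x (fx : f x = 1) : {x | f x == 1} := exist _ x (introT eqP fx).
(* The two strings supplied by the hypothesis on [f] can be swapped if necessary, because adding [g]
   twice does nothing. *)
have cross (g : bits n) : g != 0 ->
    exists (b0 : {b | f b == 0}) (b1 : {b | f b == 1}), val b0 = val b1 + g.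
  move=> /vls[b]; have gg : b + g + g = b.
    by apply/rowP => j; rewrite !mxE -addrA F2xx addr0.
  case: (F2P (f b)) => fb; case: (F2P (f (b + g))) => fbg; rewrite fb fbg // => _.
    by exists (lab0 _ fb), (lab1 _ fbg); rewrite /= gg.
  by exists (lab0 _ fbg), (lab1 _ fb).
have [a12 [a3 aE]] := row_mx_split a; have [a1 [a2 a12E]] := row_mx_split a12.
have [c12 [c3 cE]] := row_mx_split c; have [c1 [c2 c12E]] := row_mx_split c12.
have overlap (u1 u2 u3 v1 v2 v3 : 'cV[C]_(qdim n)) :
    inner u1 (weyl a1 c1 *m v1) != 0 -> inner u2 (weyl a2 c2 *m v2) != 0 ->
    inner u3 (weyl a3 c3 *m v3) != 0 ->
    inner (tensor (tensor u1 u2) u3) (weyl a c *m tensor (tensor v1 v2) v3) != 0.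
  move=> uv1 uv2 uv3; rewrite aE cE a12E c12E !weyl_tensor !inner_tensor.
  by rewrite !mulf_neq0.
pose i0 : 'I_3 := Ordinal (isT : 0 < 3)%N.
pose i1 : 'I_3 := Ordinal (isT : 1 < 3)%N.
pose i2 : 'I_3 := Ordinal (isT : 2 < 3)%N.
(* For each block of [a], the two arrangements chosen carry beta_0 and beta_1 in that block and face
   an X-basis vector with a Z-basis vector in the other two. *)
have [a1_0|/cross[b0 [b1 b01]]] := eqVneq a1 0; last first.
  exists (i1, 0, b0, b1), (i2, 0, b0, b1); split=> //=.
  by apply: overlap; rewrite ?b01 ?(weyl_zz, weyl_xz, weyl_zx).
have [a2_0|/cross[b0 [b1 b01]]] := eqVneq a2 0; last first.
  exists (i2, 0, b0, b1), (i0, 0, b0, b1); split=> //=.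
  by apply: overlap; rewrite ?b01 ?(weyl_zz, weyl_xz, weyl_zx).
have [a3_0|/cross[b0 [b1 b01]]] := eqVneq a3 0; last first.
  exists (i0, 0, b0, b1), (i1, 0, b0, b1); split=> //=.
  by apply: overlap; rewrite ?b01 ?(weyl_zz, weyl_xz, weyl_zx).
(* From here on [a] is zero and any admissible beta_0 and beta_1 will do; the all-ones string,
   nonzero since n > 0, provides a pair. *)
have [|b0 [b1 _]] := cross (const_mx 1).
  apply/eqP => /rowP/(_ (Ordinal n_gt0)); rewrite !mxE.
  by move/eqP; rewrite oner_eq0.
have zz (x : bits n) c' : inner (zket C x) (weyl 0 c' *m zket C x) != 0.
  by rewrite -{1}[x]addr0 weyl_zz.
have xx a' c' : inner (xket C c') (weyl a' c' *m xket C 0) != 0.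
  by rewrite -{1}[c']add0r weyl_xx.
have diff i (x : bits n) : x != 0 -> (i, x, b0, b1) != (i, 0, b0, b1) :> label f.
  by move=> /negPf x0; rewrite !xpair_eqE x0 andbF.
(* Without bit flips the Z-basis blocks are fixed up to sign, while a nonzero block of [c] shifts
   alpha from 0 to that block. *)
have [c1_0|c1_0] := eqVneq c1 0; last first.
  exists (i0, c1, b0, b1), (i0, 0, b0, b1); split; first exact: diff.
  by apply: overlap; rewrite ?a1_0 ?a2_0 ?a3_0.
have [c2_0|c2_0] := eqVneq c2 0; last first.
  exists (i1, c2, b0, b1), (i1, 0, b0, b1); split; first exact: diff.
  by apply: overlap; rewrite ?a1_0 ?a2_0 ?a3_0.
exists (i2, c3, b0, b1), (i2, 0, b0, b1); split; last first.
  by apply: overlap; rewrite ?a1_0 ?a2_0 ?a3_0.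
apply: diff; apply: contraTneq ac0 => c3_0.
by rewrite aE cE a12E c12E a1_0 a2_0 a3_0 c1_0 c2_0 c3_0 !row_mx0 eqxx.
Qed.

End Family.

(** * Local Clifford unitaries and stabilizer states *)

(** Both directions of conjugation are recorded, so that the set equality in [clifford] follows
    qubit by qubit. *)
Definition clifford1 (A : 'M[C]_2) :=
  [/\ A *m A ^t* = 1%:M,
      forall P, pauli1 P -> pauli1 (A *m P *m A ^t*) &
      forall P, pauli1 P -> pauli1 (A ^t* *m P *m A)].

Lemma clifford1M A B : clifford1 A -> clifford1 B -> clifford1 (A *m B).
Proof.
case=> AA pA pA' [BB pB pB']; split=> [|P pP|P pP]; rewrite adjmxM.
- by rewrite mulmxA -(mulmxA A) BB mulmx1.
- suff -> : A *m B *m P *m (B ^t* *m A ^t*) = A *m (B *m P *m B ^t*) *m A ^t*.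
    exact/pA/pB.
  by rewrite !mulmxA.
- suff -> : B ^t* *m A ^t* *m P *m (A *m B) = B ^t* *m (A ^t* *m P *m A) *m B.
    exact/pB'/pA'.
  by rewrite !mulmxA.
Qed.

Lemma clifford1_pauli A :
  pauli1 A -> A ^t* = A -> A *m A = 1%:M -> clifford1 A.
Proof.
by move=> pA adjA AA; split=> [|P pP|P pP]; rewrite adjA //;
   do !apply: pauli1_M.
Qed.

Definition hadamard : 'M[C]_2 := (sqrtC 2)^-1 *: (pauliX C + pauliZ C).

(** Merging the two factors 1/sqrt 2 leaves no square root for [field] to handle. *)
Lemma hadamard_conj B :
  hadamard *m B *m hadamard =
  2^-1 *: ((pauliX C + pauliZ C) *m B *m (pauliX C + pauliZ C)).
Proof. by rewrite -!(scalemxAl, scalemxAr) scalerA sqrtCV_sqr. Qed.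

(** [invmx] is a genuine inverse only on invertible matrices, which matters when conjugating the
    [pauli1_V] case. *)
Lemma pauli1_unit A : pauli1 A -> A \in unitmx.
Proof.
elim=> {A} [||||A B _ uA _ uB|A _ uA].
- by case: (mulmx1_unit pauliXX).
- have YY : pauliY C *m pauliY C = 1%:M.
    by rewrite pauliYE -scalemxAl -scalemxAr scalerA -expr2 sqrCi weyl1M
      !F2xx weyl100 mulr1 sgn1 scalerA mulN1r opprK scale1r.
  by case: (mulmx1_unit YY).
- by case: (mulmx1_unit pauliZZ).
- exact: unitmx1.
- by rewrite unitmx_mul uA.
- by rewrite unitmx_inv.
Qed.

Lemma clifford1_hadamard : clifford1 hadamard.
Proof.
have two0 : 2 != 0 :> C by rewrite pnatr_eq0.
have adjH : hadamard ^t* = hadamard.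
  rewrite adjmxZ sqrt2V_conj; congr (_ *: _).
  by mx2; ring.
have HH : hadamard *m hadamard = 1%:M.
  by rewrite -[X in X *m _]mulmx1 hadamard_conj; mx2; field.
suff pH P : pauli1 P -> pauli1 (hadamard *m P *m hadamard).
  by split; rewrite adjH.
elim=> {P} [||||A B _ pA _ pB|A uA pA].
- suff -> : hadamard *m pauliX C *m hadamard = pauliZ C by apply: pauli1_Z.
  by rewrite hadamard_conj; mx2; field.
(* The conjugate is -Y, written as X Y X to show it as a product of generators. *)
- suff -> : hadamard *m pauliY C *m hadamard = pauliX C *m pauliY C *m pauliX C.
    by do !apply: pauli1_M; [apply: pauli1_X|apply: pauli1_Y|apply: pauli1_X].
  by rewrite hadamard_conj; mx2; field.
- suff -> : hadamard *m pauliZ C *m hadamard = pauliX C by apply: pauli1_X.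
  by rewrite hadamard_conj; mx2; field.
- by rewrite mulmx1 HH; apply: pauli1_1.
- suff -> : hadamard *m (A *m B) *m hadamard =
      (hadamard *m A *m hadamard) *m (hadamard *m B *m hadamard).
    exact: pauli1_M.
  by rewrite !mulmxA -(mulmxA _ hadamard hadamard) HH mulmx1.
- suff -> : hadamard *m invmx A *m hadamard = invmx (hadamard *m A *m hadamard).
    exact: pauli1_V.
  have inv1 : (hadamard *m A *m hadamard) *m (hadamard *m invmx A *m hadamard) = 1%:M.
    rewrite !mulmxA -(mulmxA _ hadamard hadamard) HH mulmx1.
    by rewrite -(mulmxA _ A) mulmxV ?mulmx1 // pauli1_unit.
  exact: mulmx1_invmx.
Qed.

Lemma clifford_tensor_op m (A : 'I_m -> 'M[C]_2) :
  (forall j, clifford1 (A j)) -> clifford (tensor_op A).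
Proof.
move=> cA; have AA : tensor_op A *m (tensor_op A) ^t* = 1%:M.
  rewrite tensor_op_adj tensor_opM -tensor_op1; apply: eq_tensor_op => j.
  by case: (cA j).
split; first exact/unitarymxP.
apply/seteqP; split=> [_ [_ [B pB <-] <-]|_ [B pB <-]].
  rewrite tensor_op_adj !tensor_opM; exists (fun j => A j *m B j *m (A j) ^t*) => //.
  by move=> j; case: (cA j) => _ + _; apply.
exists (tensor_op (fun j => (A j) ^t* *m B j *m A j)).
  exists (fun j => (A j) ^t* *m B j *m A j) => // j.
  by case: (cA j) => _ _; apply.
rewrite tensor_op_adj !tensor_opM; apply: eq_tensor_op => j.
by case: (cA j) => AjAj _ _; rewrite !mulmxA AjAj mul1mx -mulmxA AjAj mulmx1.
Qed.

(** With products of single-qubit unitaries, closure under tensor products amounts to concatenating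
    families. *)
Definition local_clifford_state m (u : 'cV[C]_(qdim m)) :=
  exists2 A : 'I_m -> 'M[C]_2,
    forall j, clifford1 (A j) & u = tensor_op A *m zket C 0.

Lemma local_clifford_stabilizer m (u : 'cV[C]_(qdim m)) :
  local_clifford_state u -> stabilizer_state u.
Proof.
case=> A cA ->; exists (tensor_op A), 1.
by rewrite normr1 scale1r; split=> //; apply: clifford_tensor_op.
Qed.

Lemma local_clifford_tensor m k (u : 'cV[C]_(qdim m)) (v : 'cV[C]_(qdim k)) :
  local_clifford_state u -> local_clifford_state v ->
  local_clifford_state (tensor u v).
Proof.
case=> A cA -> [B cB ->].
exists (fun j => match split j with inl i => A i | inr i => B i end).
  by move=> j; case: (split j).
have -> : zket C (0 : bits (m + k)) = tensor (zket C 0) (zket C 0).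
  rewrite tensor_tensor_ket; apply: eq_tensor_ket => j.
  by case: (split j) => i; rewrite !mxE.
rewrite tensor_op_tensor; congr tensor; congr mulmx; apply: eq_tensor_op => j.
  by rewrite (unsplitK (inl j)).
by rewrite (unsplitK (inr j)).
Qed.

Lemma clifford1X b : clifford1 (pauliX C ^+ b).
Proof.
case: (F2P b) => ->.
  by apply: clifford1_pauli; [apply: pauli1_1|rewrite trmx1 map_mx1|rewrite mulmx1].
by apply: clifford1_pauli;
   [apply: pauli1_X|exact: pauliX_adj|exact: pauliXX].
Qed.

Lemma clifford1Z b : clifford1 (pauliZ C ^+ b).
Proof.
case: (F2P b) => ->.
  by apply: clifford1_pauli; [apply: pauli1_1|rewrite trmx1 map_mx1|rewrite mulmx1].
by apply: clifford1_pauli;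
   [apply: pauli1_Z|exact: pauliZ_adj|exact: pauliZZ].
Qed.

Lemma local_clifford_zket m (x : bits m) : local_clifford_state (zket C x).
Proof.
exists (fun j => pauliX C ^+ x 0 j) => [j|]; first exact: clifford1X.
rewrite tensor_op_ket; apply: eq_tensor_ket => j; rewrite mxE.
by case: (F2P (x 0 j)) => ->; apply: col2P; entries; ring.
Qed.

Lemma local_clifford_xket m (x : bits m) : local_clifford_state (xket C x).
Proof.
exists (fun j => pauliZ C ^+ x 0 j *m hadamard) => [j|].
  exact: clifford1M (clifford1Z _) clifford1_hadamard.
rewrite xketE tensor_op_ket; apply: eq_tensor_ket => j; rewrite mxE -mulmxA.
by congr (_ *m _); apply: col2P; entries; ring.
Qed.

Lemma state_family_stabilizer n (f : bits n -> 'F_2) (mu : label f) :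
  stabilizer_state (state_family C mu).
Proof.
apply: local_clifford_stabilizer.
have tz := local_clifford_zket; have tx := local_clifford_xket.
by case: mu => [[[[[|[|k]] lt_k] x] b0] b1]; do !apply: local_clifford_tensor.
Qed.

End Qubits.

Theorem theorem3 (R : realType) (n : nat) (f : bits n -> 'F_2)
    (hn : (0 < n)%N) (hf : vanishing_linear_structure f) :
  [/\ forall mu : label f, stabilizer_state (state_family R[i] mu),
      forall mu nu : label f, mu != nu ->
        inner (state_family R[i] mu) (state_family R[i] nu) = 0
    & ~ perfectly_discriminable (@state_family R[i] n f)].
Proof.
split=> [mu|mu nu /negPf neq_mu_nu|[s [g prob1]]].
- exact: state_family_stabilizer.
- by rewrite inner_state_family neq_mu_nu.
have psi_weyl := state_family_weyl R[i] hn hf.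
(* Two distinct labels are needed to refute a protocol that stops at once; any non-identity Weyl
   operator supplies them. *)
have [|mu [nu [neq_mu_nu _]]] := psi_weyl (const_mx 1) 0.
  apply/orP; left; apply/eqP => /rowP/(_ (Ordinal (ltn_addl (n + n) hn))).
  by rewrite !mxE => /eqP; rewrite oner_eq0.
apply: (pauli_isometry_not_discriminating neq_mu_nu
  (@inner_state_family _ _ f) psi_weyl (pauli_isometry1 _ _) (s := s) (g := g)).
by move=> la; rewrite mul1mx.
Qed.
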